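(* Let $\alpha>-1$ and $\lambda>-\tfrac12$ with $\lambda\neq 0$, and let $w(y)=(1-y^2)^{\lambda-\frac12}$. For a function $u$ on $(-1,1)$ let $$Q^{\alpha}[u](x)=\int_{-1}^{1}|x-y|^{\alpha}\,u(y)\,\mathrm{d}y .$$ Then for every integer $n\ge 2$ and every $x\in\mathbb{R}$ for which $\int_{-1}^1|x-y|^\alpha w(y)\,\mathrm{d}y$ converges (in particular for every $x\in(-1,1)$), $$x\,Q^{\alpha}\big[wC_n^{(\lambda)}\big](x)=\kappa_1\,Q^{\alpha}\big[wC_{n-1}^{(\lambda)}\big](x)+\kappa_2\,Q^{\alpha}\big[wC_{n+1}^{(\lambda)}\big](x),$$ where $$\kappa_1=\frac{(n-\alpha-1)(2\lambda+n-1)}{2n(\lambda+n)},\qquad \kappa_2=\frac{(n+1)(2\lambda+n+\alpha+1)}{2(\lambda+n)(2\lambda+n)}.$$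
   Context: $C_n^{(\lambda)}$ denotes the ultraspherical (Gegenbauer) polynomial of degree $n$ with parameter $\lambda$, in the standard normalization: $C_0^{(\lambda)}(x)=1$, $C_1^{(\lambda)}(x)=2\lambda x$, and $2(n+\lambda)\,x\,C_n^{(\lambda)}(x)=(n+2\lambda-1)\,C_{n-1}^{(\lambda)}(x)+(n+1)\,C_{n+1}^{(\lambda)}(x)$ for $n\ge1$. *)

(* Defs.v *)
From HB Require Import structures.
From mathcomp Require Import all_boot all_order all_algebra.
From mathcomp Require Import ring.
From mathcomp Require Import all_classical all_reals all_analysis.

Set Implicit Arguments.
Unset Strict Implicit.
Unset Printing Implicit Defensive.

Import Order.TTheory GRing.Theory Num.Theory.
Import numFieldNormedType.Exports.

Local Open Scope classical_set_scope.
Local Open Scope ring_scope.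

(* The last equation is the three-term recurrence at degree m + 1, solved for
   its top-degree term; see gegenbauer_rec for the usual form. *)
Fixpoint gegenbauer (R : realType) (lambda : R) (n : nat) {struct n} :
    {poly R} :=
  match n with
  | 0 => 1
  | 1 => (2 * lambda) *: 'X
  | (m.+1 as k).+1 =>
      (m.+2%:R)^-1 *: ((2 * (k%:R + lambda)) *: ('X * gegenbauer lambda k)
                       - (k%:R + 2 * lambda - 1) *: gegenbauer lambda m)
  end.

Lemma gegenbauer_rec (R : realType) (lambda : R) (n : nat) (x : R) :
  (1 <= n)%N ->
  2 * (n%:R + lambda) * x * (gegenbauer lambda n).[x] =
    (n%:R + 2 * lambda - 1) * (gegenbauer lambda n.-1).[x]
    + (n%:R + 1) * (gegenbauer lambda n.+1).[x].
Proof.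
case: n => [//|m] _.
have -> : gegenbauer lambda m.+2 =
    (m.+2%:R)^-1 *: ((2 * (m.+1%:R + lambda)) *: ('X * gegenbauer lambda m.+1)
                     - (m.+1%:R + 2 * lambda - 1) *: gegenbauer lambda m) by [].
rewrite [m.+1.-1]/= hornerZ hornerD hornerN !hornerZ hornerM hornerX.
rewrite natr1 mulrA divff ?pnatr_eq0// mul1r.
ring.
Qed.

(* Only the values on ]-1, 1[ matter, where 1 - y ^+ 2 > 0. *)
Definition gweight (R : realType) (lambda y : R) : R :=
  (1 - y ^+ 2) `^ (lambda - 2^-1).

(* At y = x the library's powR convention gives 0 `^ alpha = (alpha == 0)%:R;
   this affects a single point, hence no integral. *)
Definition riesz_kernel (R : realType) (alpha x y : R) : R :=
  `|x - y| `^ alpha.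

(* Convergence of the integral defining riesz alpha u x. When u >= 0, as for
   u = gweight lambda, this means that the integral is finite. *)
Definition riesz_converges (R : realType) (alpha : R) (u : R -> R) (x : R) :
    Prop :=
  (@lebesgue_measure R).-integrable `]-1, 1[
    (fun y => (riesz_kernel alpha x y * u y)%:E).

Definition riesz (R : realType) (alpha : R) (u : R -> R) (x : R) : R :=
  \int[@lebesgue_measure R]_(y in `]-1, 1[) (riesz_kernel alpha x y * u y).

(* Main.v *)
Require Import Defs.
From HB Require Import structures.
From mathcomp Require Import all_boot all_order all_algebra.
From mathcomp Require Import ring lra.
From mathcomp Require Import all_classical all_reals all_analysis.
From mathcomp Require Import measurable_realfun.

Import Order.TTheory GRing.Theory Num.Theory.
Import numFieldNormedType.Exports.

Local Open Scope classical_set_scope.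
Local Open Scope ring_scope.

(** Write C n for the Gegenbauer polynomials, w for the weight, k(y) for the
    kernel [`|x - y| `^ alpha] and Q(u) for the integral of k u over the open
    interval from -1 to 1. The recurrence is an integration by parts with
    vanishing boundary terms.

    The difference x Q(w (C n)) - Q(w 'X (C n)) is the integral of
    (x - y) k(y) w(y) (C n)(y). The differential equation of C n says that
    w (C n), up to the factor - n (n + 2 lambda), is the derivative of
    (1 - y^2) w (C n)', while the derivative of (x - y) k(y) is
    - (alpha + 1) k(y). Integrating by parts thus leaves a multiple of the
    integral of k w (1 - y^2) (C n)', and (1 - y^2) (C n)', like 'X (C n), is a
    combination of C n.-1 and C n.+1; collecting the coefficients gives the
    claim.

    In the proof everything is put under one integral. For a polynomial P the
    derivative of F(y) = (x - y) k(y) (1 - y^2)^(lambda + 1/2) P(y) has the form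
    k w S with S a polynomial, [flux_deriv]. As alpha + 1 and lambda + 1/2 are
    positive, F is continuous and vanishes at -1, 1 and x, so the integral of
    k w S is zero ([riesz_flux_deriv]); with P the derivative of C n, the
    polynomial S is a nonzero multiple of x (C n) - kappa_1 (C n.-1) -
    kappa_2 (C n.+1) ([flux_deriv_gegenbauer]). The derivative of F is in general
    unbounded at -1, 1 and x, but integrable as soon as k w is, since polynomials
    are bounded on the interval; [Rintegral_itvoo_FTC] is the fundamental theorem
    of calculus for this situation.

    Convergence for x inside the interval holds because powers with exponent
    above -1 are integrable ([integrable_normr_powR]), and the singularities of
    k and of w are apart from each other ([riesz_converges_gweight]). *)

(** * Differential relations for Gegenbauer polynomials *)

Section Gegenbauer.
Set Implicit Arguments.
Unset Strict Implicit.
Context (R : realType) (lambda : R).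
Notation C := (gegenbauer lambda).
Notation l := (lambda%:P).

Lemma gegenbauer_poly_rec m :
  m.+2%:R * C m.+2 =
    2 * (m.+1%:R + l) * 'X * C m.+1 - (m.+1%:R + 2 * l - 1) * C m :> {poly R}.
Proof.
have -> : C m.+2 =
    (m.+2%:R)^-1 *: ((2 * (m.+1%:R + lambda)) *: ('X * C m.+1)
                     - (m.+1%:R + 2 * lambda - 1) *: C m) by [].
rewrite -[m.+2%:R in LHS]polyC_natr mul_polyC scalerA divff ?pnatr_eq0// scale1r.
by rewrite -!mul_polyC !(polyCB,polyCM,polyCD,polyC_natr) !mulrA.
Qed.

(** The two derivative relations feed each other in a single induction: the
    derivative of the three-term recurrence, with the derivative of degree n
    eliminated by the first relation, gives the second one a degree higher, and
    the recurrence itself then gives the first one. *)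
Lemma gegenbauer_deriv_rec n :
  n.+1%:R * C n.+1 = 'X * (C n.+1)^`() - (C n)^`() /\
  (n%:R + 2 * l) * C n = (C n.+1)^`() - 'X * (C n)^`().
Proof.
elim: n => [|n [IHA IHB]].
  have -> : C 1 = (2 * lambda)%:P * 'X.
    by rewrite [LHS]/= -mul_polyC.
  have -> : C 0 = 1%:P by [].
  by rewrite derivM derivX !derivC polyCM !polyC_natr polyC1; split; ring.
have nz : n.+2%:R != 0 :> {poly R} by rewrite -polyC_natr polyC_eq0 pnatr_eq0.
have rec := gegenbauer_poly_rec n.
have drec : n.+2%:R * (C n.+2)^`() =
    2 * (n.+1%:R + l) * (C n.+1 + 'X * (C n.+1)^`())
    - (n.+1%:R + 2 * l - 1) * (C n)^`().
  have := congr1 (@deriv _) rec; rewrite -!polyC_natr.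
  rewrite !(derivM, derivB, derivD, derivC, derivX) mul0r add0r => ->.
  by rewrite !polyC_natr; ring.
have B : (n.+1%:R + 2 * l) * C n.+1 = (C n.+2)^`() - 'X * (C n.+1)^`().
  apply: (mulfI nz); rewrite mulrBr drec.
  have -> : (C n)^`() = 'X * (C n.+1)^`() - n.+1%:R * C n.+1.
    by rewrite IHA; ring.
  by ring.
split=> //; rewrite rec.
have -> : (C n.+2)^`() = (n.+1%:R + 2 * l) * C n.+1 + 'X * (C n.+1)^`().
  by rewrite B; ring.
have -> : (n.+1%:R + 2 * l - 1) * C n = (C n.+1)^`() - 'X * (C n)^`().
  by rewrite -IHB; ring.
have -> : (C n)^`() = 'X * (C n.+1)^`() - n.+1%:R * C n.+1 by rewrite IHA; ring.
by ring.
Qed.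

Lemma deriv_gegenbauer n :
  (1 - 'X ^+ 2) * (C n)^`() = (n%:R + 2 * l) * 'X * C n - n.+1%:R * C n.+1.
Proof.
have [A B] := gegenbauer_deriv_rec n.
by rewrite A -mulrA mulrCA B; ring.
Qed.

(** The Gegenbauer differential equation, obtained by differentiating
    [deriv_gegenbauer]. *)
Lemma gegenbauer_ode n :
  (1 - 'X ^+ 2) * (C n)^`()^`() - (2 * l + 1) * 'X * (C n)^`() =
  - (n%:R * (n%:R + 2 * l) * C n).
Proof.
have [_ B] := gegenbauer_deriv_rec n.
have := congr1 (@deriv _) (deriv_gegenbauer n); rewrite -!polyC_natr.
rewrite !(derivM, derivB, derivD, derivC, derivX) !polyC_natr => e.
(* The added term contains the derivative of 1 - 'X ^+ 2 as the product rule
   leaves it. *)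
apply: (addrI ((0 - (1 * 'X + 'X * 1)) * (C n)^`())); rewrite addrA e.
have -> : (C n.+1)^`() = (n%:R + 2 * l) * C n + 'X * (C n)^`().
  by rewrite B; ring.
by ring.
Qed.

End Gegenbauer.

(** * Integrals of functions unbounded at the ends of an interval *)

Section OpenIntervals.
Set Implicit Arguments.
Unset Strict Implicit.
Context {R : realType}.
Notation mu := (@lebesgue_measure R).
Implicit Types (F f g : R -> R) (a b c : R).

Lemma integrable_itv_oo_cc f a b :
  mu.-integrable `]a, b[ (EFin \o f) -> mu.-integrable `[a, b] (EFin \o f).
Proof.
move=> /integrableP[mf If].
have mf' := emeasurable_fun_itv_cc mf.
apply/integrableP; split => //.
rewrite integral_itv_bndoo//.
exact: measurableT_comp.
Qed.

Lemma integrable_itvoo_split f a b c : a < c -> c < b ->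
  mu.-integrable `]a, c[ (EFin \o f) -> mu.-integrable `]c, b[ (EFin \o f) ->
  mu.-integrable `]a, b[ (EFin \o f).
Proof.
move=> ac cb iac icb.
have {}iac : mu.-integrable `]a, c] (EFin \o f).
  apply: integrableS (integrable_itv_oo_cc iac) => //.
  exact: subset_itv_oc_cc.
move: iac icb => /integrableP[mac Iac] /integrableP[mcb Icb].
have abE : `]a, b[%classic = (`]a, c] `|` `]c, b[)%classic.
  by rewrite -itv_bndbnd_setU// bnd_simp ltW.
have mU : measurable_fun (`]a, c] `|` `]c, b[) (EFin \o f).
  exact/measurable_funU.
rewrite abE; apply/integrableP; split => //.
rewrite ge0_integral_setU//.
- exact: lte_add_pinfty.
- exact: measurableT_comp.
- apply/disj_set2P; rewrite -subset0 => z/=; rewrite !in_itv/= => -[/andP[_]].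
  by rewrite leNgt => /negbTE ->.
Qed.

Lemma le_integrable_itvoo f g a b : measurable_fun setT f ->
  (forall y, y \in `]a, b[ -> `|f y| <= g y) ->
  mu.-integrable `]a, b[ (EFin \o g) -> mu.-integrable `]a, b[ (EFin \o f).
Proof.
move=> mf fg; apply: le_integrable => //.
  by apply/measurable_EFinP; apply: measurable_funS mf.
by move=> y /fg fgy; rewrite !abse_EFin lee_fin (le_trans fgy)// ler_norm.
Qed.

(** A fundamental theorem of calculus in which [f] may blow up at both ends, as
    long as it stays integrable: [F] and the indefinite integral of [f] are
    continuous up to the ends and have the same derivative inside, so the mean
    value theorem makes their difference constant. *)
Lemma Rintegral_itvoo_FTC F f a b : a < b ->
  {within `[a, b], continuous F} ->
  (forall y, y \in `]a, b[ -> is_derive y 1 F (f y)) ->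
  (forall y, y \in `]a, b[ -> {for y, continuous f}) ->
  mu.-integrable `]a, b[ (EFin \o f) ->
  \int[mu]_(y in `]a, b[) f y = F b - F a.
Proof.
move=> ab cF dF cf intf; have intcc := integrable_itv_oo_cc intf.
pose G x := parameterized_integral mu a x f.
have dG y : y \in `]a, b[ -> is_derive y 1 G (f y).
  move=> yab; have := yab; rewrite in_itv/= => /andP[ay yb].
  have [Gy <-] := continuous_FTC1_closed yb intcc ay (cf _ yab).
  by rewrite derive1E; apply/derivableP.
have dFG y : y \in `]a, b[ -> is_derive y 1 (F - G) ((cst 0 : R -> R) y).
  move=> yab; have := dF _ yab; have := dG _ yab => ? ?.
  by apply: is_derive_eq; rewrite subrr.
have cFG : {within `[a, b], continuous (F - G)}.
  move=> y; apply: continuousD _; first exact: cF.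
  exact/continuousN/(parameterized_integral_continuous (ltW ab) intcc).
have [c _] := MVT ab dFG cFG.
rewrite mul0r !fctE/= => /eqP.
rewrite subr_eq0 => /eqP FG.
have Ga : G a = 0 by rewrite /G /parameterized_integral set_itv1 Rintegral_set1.
have -> : \int[mu]_(y in `]a, b[) f y = G b.
  rewrite /G /parameterized_integral /Rintegral [in RHS]integral_itv_bndoo//.
  by case/integrableP : intf.
by move: FG; rewrite Ga; lra.
Qed.

(** For nonnegative [f] integrability need not be assumed: over compact
    subintervals the integral is an increment of the nondecreasing [F], hence at
    most [F b - F a], and monotone convergence carries the bound to the whole
    interval. *)
Lemma ge0_integrable_itvoo_FTC F f a b : a < b ->
  {within `[a, b], continuous F} ->
  (forall y, y \in `]a, b[ -> is_derive y 1 F (f y)) ->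
  (forall y, y \in `]a, b[ -> {for y, continuous f}) ->
  (forall y, y \in `]a, b[ -> 0 <= f y) ->
  mu.-integrable `]a, b[ (EFin \o f).
Proof.
move=> ab cF dF cf f0.
have mf : measurable_fun `]a, b[ f.
  apply: open_continuous_measurable_fun; first exact: interval_open.
  by move=> y; rewrite inE => /cf.
have FS p q : a <= p -> p < q -> q <= b -> F p <= F q.
  move=> ap pq qb; rewrite -subr_ge0.
  have sub : `]p, q[ `<=` `]a, b[ by apply: subset_itvW.
  have dFpq y : y \in `]p, q[ -> is_derive y 1 F (f y) by move=> /sub/dF.
  have cFpq : {within `[p, q], continuous F}.
    by apply: continuous_subspaceW cF; apply: subset_itvScc.
  have [c cpq FE] := MVT pq dFpq cFpq.
  by rewrite FE mulr_ge0 ?subr_ge0 ?(ltW pq)// f0//; exact: sub.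
(* The shift n + 3 keeps all the compact intervals nondegenerate. *)
pose e n : R := (b - a) / n.+3%:R.
have e0 n : 0 < e n by rewrite divr_gt0// subr_gt0.
have ed n m : (n <= m)%N -> e m <= e n.
  by move=> nm; rewrite ler_pM2l ?subr_gt0// lef_pV2 ?posrE// ler_nat.
have eh n : a + e n < b - e n.
  have : e n <= e 0 by exact: ed.
  have -> : e 0 = (b - a) / 3 by [].
  by move: (e n) => en; lra.
pose E n : set R := `[a + e n, b - e n]%classic.
have Esub n : E n `<=` `]a, b[.
  move=> y; rewrite /E/= !in_itv/= => /andP[h1 h2]; have := e0 n.
  by move=> en; apply/andP; split; lra.
have EU : \bigcup_n E n = `]a, b[%classic.
  apply/seteqP; split => y; first by case=> n _ /Esub.
  rewrite /= in_itv/= => /andP[ay yb].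
  pose m := Num.min (y - a) (b - y).
  have m0 : 0 < m by rewrite lt_min !subr_gt0 ay yb.
  pose N := Num.bound ((b - a) / m).
  have ba0 : 0 <= (b - a) / m by rewrite divr_ge0// ltW// subr_gt0.
  have eN : e N <= m.
    rewrite /e ler_pdivrMr// mulrC -ler_pdivrMr//.
    apply: (le_trans (ltW (archi_boundP ba0))).
    by rewrite ler_nat -/N -addn3 leq_addr.
  exists N => //; rewrite /E/= in_itv/=.
  by move: eN; rewrite le_min => /andP[h1 h2]; apply/andP; split; lra.
have intE n : (\int[mu]_(y in E n) (f y)%:E <= (F b - F a)%:E)%E.
  have en := e0 n.
  rewrite (@continuous_FTC2 _ f F).
  - rewrite -EFinB lee_fin.
    have := @FS a (a + e n); have := @FS (b - e n) b.
    have := eh n; move: en; set p := a + _; set q := b - _ => en pq h1 h2.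
    have : F q <= F b by apply: h1; rewrite /p /q in pq *; lra.
    have : F a <= F p by apply: h2; rewrite /p /q in pq *; lra.
    by lra.
  - exact: eh.
  - apply: continuous_in_subspaceT => y; rewrite inE => /Esub; exact: cf.
  - have cFy y : y \in `]a, b[ -> {for y, continuous F}.
      move=> /dF[dFy _]; exact/differentiable_continuous/derivable1_diffP.
    have := eh n => pq.
    split.
    + move=> y /subset_itv_oo_cc /Esub /dF[dFy _]; exact: dFy.
    + apply/cvg_at_right_filter/cFy; apply: (Esub n).
      by rewrite /E/= in_itv/= lexx ltW.
    + apply/cvg_at_left_filter/cFy; apply: (Esub n).
      by rewrite /E/= in_itv/= lexx ltW.
  - by move=> y /subset_itv_oo_cc /Esub /dF[_ <-]; rewrite derive1E.
apply/integrableP; split; first exact/measurable_EFinP.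
have -> : (\int[mu]_(y in `]a, b[) `|(EFin \o f) y| =
           \int[mu]_(y in `]a, b[) (f y)%:E)%E.
  by apply: eq_integral => y; rewrite inE => /f0 fy; rewrite /= ger0_norm.
apply: (@le_lt_trans _ _ (F b - F a)%:E); last exact: ltry.
rewrite -EU; apply: cvge_le; last first.
  apply: ge0_nondecreasing_set_cvg_integral.
  - apply/nondecreasing_seqP => n; apply/subsetPset => y.
    rewrite /E/= !in_itv/= => /andP[h1 h2]; have := ed n n.+1 (leqnSn n).
    by move=> he; apply/andP; split; lra.
  - by move=> n; exact: measurable_itv.
  - by move=> n; apply: measurable_funS (Esub n) _ => //; exact/measurable_EFinP.
  - by move=> n y /Esub/f0; rewrite lee_fin.
by apply: nearW => n; exact: intE.
exact: eventually_filter.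
Qed.

End OpenIntervals.

(** * Powers of absolute values, and convergence of the kernel integral *)

Section Powers.
Set Implicit Arguments.
Unset Strict Implicit.
Context {R : realType}.
Notation mu := (@lebesgue_measure R).

Lemma is_derive_normr_powR_id (a t : R) : t != 0 ->
  is_derive t 1 (fun t : R => `|t| `^ a) (a * (Num.sg t * `|t| `^ (a - 1))).
Proof.
move=> t0.
have dn : is_derive t 1 (fun t : R => `|t|) (Num.sg t).
  apply: (@near_eq_is_derive _ _ _ (Num.sg t \*: id)); last first.
    by apply: is_derive_eq; rewrite /GRing.scale/= mulr1.
  have [tp|tn|/eqP] := ltgtP 0 t; last by rewrite eq_sym (negbTE t0).
  - near=> s; have s0 : 0 < s by near: s; exact: lt_nbhsr.
    by rewrite /= gtr0_sg// scale1r gtr0_norm.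
  - near=> s; have s0 : s < 0 by near: s; exact: lt_nbhsl.
    by rewrite /= ltr0_sg// scaleN1r ltr0_norm.
have dp : is_derive `|t| 1 (@powR R ^~ a) (a * `|t| `^ (a - 1)).
  by apply: is_derive1_powR; rewrite normr_gt0.
have := @is_derive1_comp _ _ _ _ _ _ dp dn.
by move=> h; apply: (is_derive_eq h); rewrite (mulrC (Num.sg t)) mulrA.
Unshelve. all: by end_near. Qed.

Lemma is_derive_normr_powR (g : R -> R) (dg a y : R) : g y != 0 ->
  is_derive y 1 g dg ->
  is_derive y 1 (fun y => `|g y| `^ a)
    (a * Num.sg (g y) * `|g y| `^ (a - 1) * dg).
Proof.
move=> gy dgy; have d := is_derive_normr_powR_id a gy.
have h := @is_derive1_comp _ (fun t : R => `|t| `^ a) g _ _ _ d dgy.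
by apply: (is_derive_eq h); rewrite !mulrA.
Qed.

Lemma continuous_at_normr_powR_id (a t : R) : t != 0 ->
  {for t, continuous (fun t : R => `|t| `^ a)}.
Proof.
move=> /is_derive_normr_powR_id-/(_ a)[d _].
exact/differentiable_continuous/derivable1_diffP.
Qed.

(** The absolute value matters on the negative side, where [powR] is constantly
    1: with it the power is continuous across 0. *)
Lemma continuous_normr_powR_id (a : R) : 0 < a ->
  continuous (fun t : R => `|t| `^ a).
Proof.
move=> a0 t; have [->|t0] := eqVneq t 0; last exact: continuous_at_normr_powR_id.
apply/cvgrPdist_lt => e e0.
rewrite normr0 powR0 ?gt_eqF//.
exists (e `^ a^-1); first exact: powR_gt0.
move=> s /=; rewrite sub0r normrN => hs.
rewrite sub0r normrN ger0_norm ?powR_ge0//.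
rewrite -[ltRHS](powRr1 (ltW e0)) -(@mulVf _ a) ?gt_eqF// powRrM.
by rewrite gt0_ltr_powR// ?nnegrE ?powR_ge0.
Qed.

Lemma continuous_at_normr_powR (g : R -> R) (a y : R) : g y != 0 ->
  {for y, continuous g} -> {for y, continuous (fun y => `|g y| `^ a)}.
Proof.
move=> gy cg; apply: (cvg_comp _ (fun t => `|t| `^ a) cg).
exact: continuous_at_normr_powR_id.
Qed.

Lemma continuous_normr_powR (g : R -> R) (a : R) : 0 < a ->
  continuous g -> continuous (fun y => `|g y| `^ a).
Proof.
move=> a0 cg y; apply: (cvg_comp _ (fun t => `|t| `^ a) (cg y)).
exact: continuous_normr_powR_id.
Qed.

(** Bounding by both ends covers nonnegative exponents, for which the power
    increases, and negative ones, for which it decreases. *)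
Lemma powR_le_endpoints (a m M t : R) : 0 < m -> m <= t -> t <= M ->
  t `^ a <= m `^ a + M `^ a.
Proof.
move=> m0 mt tM; have t0 := lt_le_trans m0 mt.
have [a0|a0] := leP 0 a.
  apply: (@le_trans _ _ (M `^ a)); last by rewrite lerDr powR_ge0.
  by rewrite ge0_ler_powR// nnegrE ltW// (lt_le_trans t0).
have -> : t `^ a = (t `^ (- a))^-1 by rewrite powRN invrK.
have -> : m `^ a = (m `^ (- a))^-1 by rewrite powRN invrK.
rewrite (@le_trans _ _ (m `^ (- a))^-1)// ?lerDl ?powR_ge0//.
rewrite lef_pV2 ?posrE ?powR_gt0//.
by rewrite ge0_ler_powR ?oppr_ge0 ?nnegrE// ltW.
Qed.

Lemma measurable_normr_powR (c a : R) :
  measurable_fun setT (fun y : R => `|c - y| `^ a).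
Proof.
apply: (measurableT_comp (@measurable_powR R _)).
apply: measurableT_comp => //; exact: measurable_funB.
Qed.

(** On an interval where [c - y] has the constant sign [s], the function
    [- s * `|c - y| `^ (m + 1) / (m + 1)] is an antiderivative that is continuous
    up to the ends because [m + 1] is positive. *)
Lemma integrable_normr_powR_side (c m a b s : R) : -1 < m -> a < b ->
  s * s = 1 -> (forall y, y \in `]a, b[ -> Num.sg (c - y) = s) ->
  mu.-integrable `]a, b[ (fun y => (`|c - y| `^ m)%:E).
Proof.
move=> m1 ab ss sgE.
have m10 : 0 < m + 1 by lra.
have ynz y : y \in `]a, b[ -> c - y != 0.
  move=> /sgE sE; rewrite -sgr_eq0 sE; apply/eqP => s0.
  by move: ss; rewrite s0; lra.
pose k := - s / (m + 1).
pose F (y : R) := k * `|c - y| `^ (m + 1).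
pose f (y : R) := `|c - y| `^ m.
have csub : continuous (fun y : R => c - y).
  by move=> y; apply: cvgB; [exact: cvg_cst|exact: cvg_id].
have cF : continuous F.
  move=> y; apply: cvgM; first exact: cvg_cst.
  exact: (continuous_normr_powR m10 csub).
have dF y : y \in `]a, b[ -> is_derive y 1 F (f y).
  move=> yab.
  have d1 : is_derive y 1 (fun y : R => c - y) (-1).
    have := is_deriveB (is_derive_cst c y 1) (is_derive_id y 1).
    by rewrite sub0r.
  have d2 := is_derive_normr_powR (g := fun y => c - y) (m + 1) (ynz _ yab) d1.
  have h := is_deriveZ k d2.
  apply: (is_derive_eq h).
  rewrite (sgE _ yab) addrK /GRing.scale/=.
  transitivity (s * s * ((m + 1) / (m + 1)) * `|c - y| `^ m).
    by rewrite /k; ring.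
  by rewrite ss divff ?gt_eqF// !mul1r.
have cf y : y \in `]a, b[ -> {for y, continuous f}.
  move=> yab.
  have h := continuous_at_normr_powR (g := fun y => c - y) (a := m)
    (ynz _ yab) (csub y).
  exact: h.
apply: (ge0_integrable_itvoo_FTC ab (continuous_subspaceT cF) dF cf).
by move=> y _; exact: powR_ge0.
Qed.

Lemma integrable_normr_powR (c m a b : R) : -1 < m -> a < b ->
  mu.-integrable `]a, b[ (fun y => (`|c - y| `^ m)%:E).
Proof.
move=> m1 ab.
have left p q : p < q -> q <= c ->
    mu.-integrable `]p, q[ (fun y => (`|c - y| `^ m)%:E).
  move=> pq qc; apply: (@integrable_normr_powR_side _ _ _ _ 1) => //.
    by rewrite mulr1.
  move=> y; rewrite in_itv/= => /andP[_ yq]; rewrite gtr0_sg// subr_gt0.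
  exact: lt_le_trans yq qc.
have right p q : p < q -> c <= p ->
    mu.-integrable `]p, q[ (fun y => (`|c - y| `^ m)%:E).
  move=> pq cp; apply: (@integrable_normr_powR_side _ _ _ _ (-1)) => //.
    by rewrite mulrNN mulr1.
  move=> y; rewrite in_itv/= => /andP[py _]; rewrite ltr0_sg// subr_lt0.
  exact: le_lt_trans cp py.
have [bc|cb] := leP b c; first exact: left.
have [ca|ac] := leP c a; first exact: right.
by apply: (integrable_itvoo_split ac cb); [exact: left|exact: right].
Qed.

Lemma measurable_gweight (lambda : R) : measurable_fun setT (gweight lambda).
Proof.
apply: (measurableT_comp (@measurable_powR R _)).
apply: measurable_funB => //; exact: measurable_funX.
Qed.

(** Of the two factors of [(1 - y) `^ m * (1 + y) `^ m], the one whose base lies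
    between 1 and 2 is bounded by the constant [K]. *)
Lemma integrable_gweight (lambda : R) : - 2^-1 < lambda ->
  mu.-integrable `]-1, 1[ (fun y => (gweight lambda y)%:E).
Proof.
move=> hl; set m := lambda - 2^-1; have m1 : -1 < m by rewrite /m; lra.
pose K : R := 1 `^ m + 2 `^ m.
have lt11 : -1 < 1 :> R by lra.
apply: (le_integrable_itvoo (g :=
  fun y => K * (`|1 - y| `^ m + `|-1 - y| `^ m))).
  exact: measurable_gweight.
  move=> y; rewrite /= in_itv/= => /andP[y1 y2].
  rewrite ger0_norm ?powR_ge0//.
  rewrite /gweight -/m (_ : 1 - y ^+ 2 = (1 - y) * (1 + y)); last by ring.
  rewrite powRM; [|lra|lra].
  rewrite ger0_norm; last lra.
  rewrite (_ : `|-1 - y| = 1 + y); last by rewrite ler0_norm; lra.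
  have [y0|y0] := leP 0 y.
    have : (1 + y) `^ m <= K by apply: powR_le_endpoints; lra.
    have := powR_ge0 (1 - y) m; have := powR_ge0 (1 + y) m.
    by nra.
  have : (1 - y) `^ m <= K by apply: powR_le_endpoints; lra.
  have := powR_ge0 (1 - y) m; have := powR_ge0 (1 + y) m.
  by nra.
apply: (@integrableZl _ _ _ mu _ _ K
  (fun y => (`|1 - y| `^ m)%:E + (`|-1 - y| `^ m)%:E)%E) => //.
by apply: integrableD => //; exact: integrable_normr_powR.
Qed.

(** The kernel and the weight are each integrable, and their singularities sit
    at different points: where [y] is at distance at least [r] from [x] the kernel
    is bounded, and closer to [x] the weight is. *)
Lemma riesz_converges_gweight (alpha lambda x : R) :
  -1 < alpha -> - 2^-1 < lambda -> -1 < x < 1 ->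
  riesz_converges alpha (gweight lambda) x.
Proof.
move=> ha hl /andP[x1 x2]; set m := lambda - 2^-1.
(* Half the distance from x to the nearer end, so that `|x - y| < r also keeps
   y at distance r from the ends. *)
pose r := (1 - `|x|) / 2.
have xlt : `|x| < 1 by rewrite ltr_norml x1 x2.
have r0 : 0 < r by rewrite /r; lra.
pose K : R := r `^ alpha + 2 `^ alpha.
pose L : R := r `^ m + 1 `^ m.
have lt11 : -1 < 1 :> R by lra.
apply: (le_integrable_itvoo (g :=
  fun y => K * gweight lambda y + L * `|x - y| `^ alpha)).
- apply: measurable_funM; first exact: measurable_normr_powR.
  exact: measurable_gweight.
- move=> y; rewrite /= in_itv/= => /andP[y1 y2].
  rewrite /riesz_kernel.
  have k0 : 0 <= `|x - y| `^ alpha by exact: powR_ge0.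
  have w0 : 0 <= gweight lambda y by exact: powR_ge0.
  rewrite ger0_norm ?mulr_ge0//.
  have K0 : 0 <= K by rewrite addr_ge0 ?powR_ge0.
  have L0 : 0 <= L by rewrite addr_ge0 ?powR_ge0.
  have [rxy|xyr] := leP r `|x - y|.
    have : `|x - y| `^ alpha <= K.
      by apply: powR_le_endpoints => //; rewrite ler_norml; lra.
    by nra.
  have : gweight lambda y <= L.
    apply: powR_le_endpoints => //; last by rewrite gerBl sqr_ge0.
    have yr : `|y| <= 1 - r.
      have := ler_normB x (x - y); rewrite subKr.
      by move: xyr; rewrite /r; lra.
    rewrite -[y ^+ 2]real_normK ?num_real//.
    have := normr_ge0 y; nra.
  by nra.
- apply: (@integrableD _ _ _ mu _ _ (fun y => K%:E * (gweight lambda y)%:E)%E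
    (fun y => L%:E * (`|x - y| `^ alpha)%:E)%E) => //.
    by apply: integrableZl => //; exact: integrable_gweight.
  by apply: integrableZl => //; exact: integrable_normr_powR.
Qed.

End Powers.

(** * Integration by parts against the kernel *)

Section RieszPolynomials.
Set Implicit Arguments.
Unset Strict Implicit.
Context {R : realType}.
Notation mu := (@lebesgue_measure R).

Lemma riesz_integrand_integrable (alpha lambda x : R) (p : {poly R}) :
  riesz_converges alpha (gweight lambda) x ->
  mu.-integrable `]-1, 1[
    (EFin \o (fun y => riesz_kernel alpha x y * (gweight lambda y * p.[y]))).
Proof.
move=> cvx.
have ltN11 : -1 <= 1 :> R by lra.
have cp : {within `[-1, 1], continuous (fun y : R => `|p.[y]|)}.
  apply: continuous_subspaceT => y; apply: continuous_comp.
    exact: continuous_horner.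
  exact: norm_continuous.
have [c _ cmax] := EVT_max ltN11 cp.
apply: (le_integrable_itvoo (g :=
  fun y => `|p.[c]| * (riesz_kernel alpha x y * gweight lambda y))).
- apply: measurable_funM; first exact: measurable_normr_powR.
  apply: measurable_funM; first exact: measurable_gweight.
  by apply: continuous_measurable_fun; exact: continuous_horner.
- move=> y yab.
  rewrite !normrM !(ger0_norm (powR_ge0 _ _)) mulrA mulrC.
  rewrite ler_wpM2r ?mulr_ge0 ?powR_ge0// cmax//.
  exact: subset_itv_oo_cc.
- by apply: (@integrableZl _ _ _ mu _ _ _
    (fun y => (riesz_kernel alpha x y * gweight lambda y)%:E)).
Qed.

Definition riesz_poly (alpha lambda x : R) (p : {poly R}) : R :=
  riesz alpha (fun y => gweight lambda y * p.[y]) x.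

Lemma eq_riesz_poly (alpha lambda x : R) (p q : {poly R}) :
  (forall y, p.[y] = q.[y]) ->
  riesz_poly alpha lambda x p = riesz_poly alpha lambda x q.
Proof. by move=> pq; apply: eq_Rintegral => y _; rewrite pq. Qed.

Lemma riesz_polyD alpha lambda x (p q : {poly R}) :
  riesz_converges alpha (gweight lambda) x ->
  riesz_poly alpha lambda x (p + q) =
  riesz_poly alpha lambda x p + riesz_poly alpha lambda x q.
Proof.
move=> cvx; rewrite /riesz_poly /riesz.
rewrite -RintegralD//; [|exact: riesz_integrand_integrable..].
by apply: eq_Rintegral => y _; rewrite hornerD; ring.
Qed.

Lemma riesz_polyZ alpha lambda x (c : R) (p : {poly R}) :
  riesz_converges alpha (gweight lambda) x ->
  riesz_poly alpha lambda x (c *: p) = c * riesz_poly alpha lambda x p.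
Proof.
move=> cvx; rewrite /riesz_poly /riesz.
rewrite -RintegralZl//; last exact: riesz_integrand_integrable.
by apply: eq_Rintegral => y _; rewrite hornerZ; ring.
Qed.

(** Multiplied by [riesz_kernel alpha x y * gweight lambda y], this is the
    derivative in [y] of
    [(x - y) * `|x - y| `^ alpha * (1 - y ^+ 2) `^ (lambda + 2^-1) * P.[y]],
    for [y] between -1 and 1 and distinct from [x]. *)
Definition flux_deriv (alpha lambda x : R) (P : {poly R}) : {poly R} :=
  (x%:P - 'X) * ((1 - 'X ^+ 2) * P^`() - (2 * lambda + 1) *: ('X * P))
  - (alpha + 1) *: ((1 - 'X ^+ 2) * P).

(** The antiderivative is continuous and vanishes where [x - y] or [1 - y ^+ 2]
    does, since both exponents [alpha + 1] and [lambda + 2^-1] are positive. The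
    kernel may be singular at [y = x], whence an interval on one side of [x]. *)
Lemma Rintegral_flux_deriv_side alpha lambda x a b s (P : {poly R}) :
  -1 < alpha -> - 2^-1 < lambda ->
  riesz_converges alpha (gweight lambda) x ->
  -1 <= a -> a < b -> b <= 1 -> s * s = 1 ->
  (forall y, y \in `]a, b[ -> Num.sg (x - y) = s) ->
  (x - a) * (1 - a ^+ 2) = 0 -> (x - b) * (1 - b ^+ 2) = 0 ->
  \int[mu]_(y in `]a, b[) (riesz_kernel alpha x y *
      (gweight lambda y * (flux_deriv alpha lambda x P).[y])) = 0.
Proof.
move=> ha hl cvx a1 ab b1 ss sgE Fa Fb.
have a10 : 0 < alpha + 1 by lra.
have l10 : 0 < lambda + 2^-1 by lra.
pose g1 (y : R) := x - y.
pose g2 (y : R) := 1 - y ^+ 2.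
(* F is written with s * `|x - y| in place of x - y, and with an absolute value
   around 1 - y ^+ 2, to be continuous on the whole line. *)
pose A (y : R) := `|g1 y| `^ (alpha + 1).
pose B (y : R) := `|g2 y| `^ (lambda + 2^-1).
pose F (y : R) := s * (A y * (B y * P.[y])).
pose f (y : R) := riesz_kernel alpha x y *
      (gweight lambda y * (flux_deriv alpha lambda x P).[y]).
have cg1 : continuous g1.
  by move=> y; apply: cvgB; [exact: cvg_cst|exact: cvg_id].
have g2E : g2 = horner (1 - 'X ^+ 2).
  by apply/funext => y; rewrite !hornerE.
have cg2 : continuous g2 by rewrite g2E; exact: continuous_horner.
have cF : continuous F.
  move=> y; apply: cvgM; first exact: cvg_cst.
  apply: cvgM; first exact: (continuous_normr_powR a10 cg1).
  apply: cvgM; first exact: (continuous_normr_powR l10 cg2).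
  exact: continuous_horner.
have F0 y : (x - y) * (1 - y ^+ 2) = 0 -> F y = 0.
  move=> /eqP; rewrite mulf_eq0 /F /A /B /g1 /g2 => /orP[] /eqP ->.
    by rewrite normr0 powR0 ?gt_eqF// mul0r mulr0.
  by rewrite normr0 (powR0 (lt0r_neq0 l10)) ?mul0r ?mulr0.
have g1n y : y \in `]a, b[ -> g1 y != 0.
  move=> /sgE sE; rewrite -sgr_eq0 sE; apply/eqP => s0.
  by move: ss; rewrite s0; lra.
have g2p y : y \in `]a, b[ -> 0 < g2 y.
  rewrite in_itv/= /g2 => /andP[ay yb].
  rewrite (_ : 1 - y ^+ 2 = (1 - y) * (1 + y)); last by ring.
  by apply: mulr_gt0; lra.
have dF y : y \in `]a, b[ -> is_derive y 1 F (f y).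
  move=> yab.
  have d1 : is_derive y 1 g1 (-1).
    have := is_deriveB (is_derive_cst x y 1) (is_derive_id y 1).
    by rewrite sub0r.
  have d2 : is_derive y 1 g2 (- (2 * y)).
    rewrite g2E; apply: (is_derive_eq (is_derive_poly _ _)).
    by rewrite derivB derivXn derivC !hornerE /=; ring.
  have dA := is_derive_normr_powR (alpha + 1) (g1n _ yab) d1.
  have dB := is_derive_normr_powR (lambda + 2^-1) (lt0r_neq0 (g2p _ yab)) d2.
  have h := is_deriveZ s (is_deriveM dA (is_deriveM dB (is_derive_poly P y))).
  apply: (is_derive_eq h).
  rewrite /GRing.scale !fctE /= (gtr0_norm (g2p _ yab)) (gtr0_sg (g2p _ yab)).
  rewrite (sgE _ yab) addrK.
  have -> : `|g1 y| `^ (alpha + 1) = `|g1 y| * `|g1 y| `^ alpha.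
    by rewrite -[alpha in RHS](addrK 1) mulr_powRB1.
  have -> : g2 y `^ (lambda + 2^-1) = g2 y * g2 y `^ (lambda + 2^-1 - 1).
    by rewrite mulr_powRB1// ltW// g2p.
  have -> : `|g1 y| = s * g1 y.
    by rewrite -(sgE _ yab) normrEsg.
  rewrite /f /riesz_kernel /gweight.
  rewrite (_ : `|x - y| = s * g1 y); last by rewrite -(sgE _ yab) normrEsg.
  rewrite (_ : lambda - 2^-1 = lambda + 2^-1 - 1); last by field.
  rewrite -/(g2 y); set K := powR _ alpha; set W := powR _ _.
  rewrite /flux_deriv !hornerE /= /g1 /g2.
  transitivity (s * s * ((x - y) * K * W *
      (g2 y * P^`().[y] - (2 * lambda + 1) * y * P.[y]))
    - s * s * (alpha + 1) * K * W * g2 y * P.[y]).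
    by rewrite /g2; field.
  by rewrite ss /g2; ring.
have cf y : y \in `]a, b[ -> {for y, continuous f}.
  move=> yab.
  apply: cvgM.
    exact: (continuous_at_normr_powR (a := alpha) (g1n _ yab) (cg1 y)).
  apply: cvgM; last exact: continuous_horner.
  have wd : derivable (@powR R ^~ (lambda - 2^-1)) (g2 y) 1.
    by apply: derivable_powR; rewrite in_itv/= andbT g2p.
  have cw : {for g2 y, continuous (@powR R ^~ (lambda - 2^-1))}.
    exact/differentiable_continuous/derivable1_diffP.
  exact: (cvg_comp _ _ (cg2 y) cw).
have intf : mu.-integrable `]a, b[ (EFin \o f).
  have := riesz_integrand_integrable (flux_deriv alpha lambda x P) cvx.
  apply: integrableS => //.
  exact: subset_itvW.
rewrite (Rintegral_itvoo_FTC ab (continuous_subspaceT cF) dF cf intf).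
by rewrite !F0// subrr.
Qed.

(** If [x] is not inside the interval, then [x - y] has one sign on all of it;
    otherwise the integral is cut at [x]. *)
Lemma riesz_flux_deriv alpha lambda x (P : {poly R}) :
  -1 < alpha -> - 2^-1 < lambda ->
  riesz_converges alpha (gweight lambda) x ->
  riesz_poly alpha lambda x (flux_deriv alpha lambda x P) = 0.
Proof.
move=> ha hl cvx; rewrite /riesz_poly /riesz.
have lt11 : -1 < 1 :> R by lra.
have z1 : (x - 1) * (1 - 1 ^+ 2) = 0 by ring.
have z2 : (x - -1) * (1 - (-1) ^+ 2) = 0 by ring.
have zx : (x - x) * (1 - x ^+ 2) = 0 by ring.
have pos p q : q <= x -> forall y, y \in `]p, q[ -> Num.sg (x - y) = 1.
  move=> qx y; rewrite in_itv/= => /andP[_ yq]; rewrite gtr0_sg// subr_gt0.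
  exact: lt_le_trans yq qx.
have neg p q : x <= p -> forall y, y \in `]p, q[ -> Num.sg (x - y) = -1.
  move=> xp y; rewrite in_itv/= => /andP[py _]; rewrite ltr0_sg// subr_lt0.
  exact: le_lt_trans xp py.
have s1 : 1 * 1 = 1 :> R by ring.
have sN1 : -1 * -1 = 1 :> R by ring.
have [x1|x1] := leP 1 x.
  exact: (Rintegral_flux_deriv_side P ha hl cvx _ lt11 _ s1 (pos _ _ x1)).
have [xN1|xN1] := leP x (-1).
  exact: (Rintegral_flux_deriv_side P ha hl cvx _ lt11 _ sN1 (neg _ _ xN1)).
pose f y := riesz_kernel alpha x y *
  (gweight lambda y * (flux_deriv alpha lambda x P).[y]).
rewrite -[LHS]/(\int[mu]_(y in `]-1, 1[) f y).
have intf : mu.-integrable `]-1, 1[ (EFin \o f).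
  exact: riesz_integrand_integrable.
have := @Rintegral_itvB R f (BRight (-1)) (BLeft 1) x intf.
rewrite !bnd_simp => /(_ (ltW xN1) x1) /eqP; rewrite subr_eq => /eqP ->.
rewrite (Rintegral_flux_deriv_side P ha hl cvx _ _ _ sN1
  (neg _ _ (lexx _)))// ?(ltW xN1)//.
rewrite -Rintegral_itv_bndo_bndc; last first.
  by apply: integrableS intf => //; apply: subset_itvl; rewrite bnd_simp ltW.
by rewrite (Rintegral_flux_deriv_side P ha hl cvx _ _ _ s1
  (pos _ _ (lexx _)))// ?addr0// ltW.
Qed.

(** For the derivative of the Gegenbauer polynomial of degree n, the differential
    equation turns the first part of [flux_deriv] into a multiple of [x - y] times
    that polynomial, [deriv_gegenbauer] rewrites the second part, and the
    three-term recurrence absorbs the remaining multiplications by [y]: the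
    coefficients of the theorem come out, times a nonzero constant. *)
Lemma flux_deriv_gegenbauer (alpha lambda x : R) (n : nat) (y : R) :
  (0 < n)%N -> - 2^-1 < lambda ->
  (flux_deriv alpha lambda x (gegenbauer lambda n)^`()).[y] =
  - (n%:R * (n%:R + 2 * lambda)) *
   (x * (gegenbauer lambda n).[y]
   - ((n%:R - alpha - 1) * (2 * lambda + n%:R - 1))
        / (2 * n%:R * (lambda + n%:R)) * (gegenbauer lambda n.-1).[y]
   - ((n%:R + 1) * (2 * lambda + n%:R + alpha + 1))
        / (2 * (lambda + n%:R) * (2 * lambda + n%:R))
        * (gegenbauer lambda n.+1).[y]).
Proof.
move=> n0 hl; have n1 : 1 <= n%:R :> R by rewrite ler1n.
have rec := gegenbauer_rec lambda y n0.
have D := congr1 (fun p => p.[y]) (deriv_gegenbauer lambda n).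
have O := congr1 (fun p => p.[y]) (gegenbauer_ode lambda n).
move: D O; rewrite -!polyC_natr !hornerE /= -[n.+1%:R]natr1.
set c := (gegenbauer lambda n).[y] in rec *.
set cp := (gegenbauer lambda n.+1).[y] in rec *.
set cm := (gegenbauer lambda n.-1).[y] in rec *.
move=> D O.
rewrite O -(mulrA (alpha + 1)) D.
have n1n : n%:R + 1 != 0 :> R by apply: lt0r_neq0; lra.
have -> : cp = (2 * (n%:R + lambda) * y * c
               - (n%:R + 2 * lambda - 1) * cm) / (n%:R + 1).
  by rewrite rec [X in X / _]addrC addKr mulrC mulKf.
move: n1 n1n; move: (n%:R : R) => N n1 n1n {rec D O}.
by field; do !(apply/andP; split); apply: lt0r_neq0; lra.
Qed.

End RieszPolynomials.

Theorem theorem2p4 (R : realType) (alpha lambda : R)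
    (halpha : -1 < alpha) (hlambda : - 2^-1 < lambda) (hlambda0 : lambda != 0) :
  let w := gweight lambda in
  let wC := fun m y => w y * (gegenbauer lambda m).[y] in
  (forall x : R, -1 < x < 1 -> riesz_converges alpha w x) /\
  (forall (n : nat) (x : R), (2 <= n)%N -> riesz_converges alpha w x ->
    x * riesz alpha (wC n) x =
      ((n%:R - alpha - 1) * (2 * lambda + n%:R - 1))
        / (2 * n%:R * (lambda + n%:R)) * riesz alpha (wC n.-1) x
      + ((n%:R + 1) * (2 * lambda + n%:R + alpha + 1))
        / (2 * (lambda + n%:R) * (2 * lambda + n%:R))
        * riesz alpha (wC n.+1) x).
Proof.
move=> w wC; split=> [x x11|n x n2 cvx]; first exact: riesz_converges_gweight.
have n0 : (0 < n)%N by exact: ltnW.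
have n1 : 1 <= n%:R :> R by rewrite ler1n.
set k1 := (X in _ = X * _ + _); set k2 := (X in _ = _ + X * _).
set C := gegenbauer lambda.
have := riesz_flux_deriv (C n)^`() halpha hlambda cvx.
rewrite (@eq_riesz_poly _ _ _ _ _ (- (n%:R * (n%:R + 2 * lambda)) *:
    (x *: C n + - k1 *: C n.-1 + - k2 *: C n.+1))); last first.
  by move=> y; rewrite flux_deriv_gegenbauer// !hornerE /= !mulNr.
rewrite riesz_polyZ// => /eqP; rewrite mulf_eq0 oppr_eq0.
rewrite gt_eqF ?orFb; last by apply: mulr_gt0; lra.
rewrite !riesz_polyD// !riesz_polyZ// => /eqP.
by rewrite /riesz_poly; lra.
Qed.
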